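(* Let $z(x,y)>0$ be a smooth solution of the constant astigmatism equation $z_{yy}+(1/z)_{xx}+2=0$ on a simply connected open set $U\subset\mathbb R^2$, and let $\xi,\eta$ be corresponding potentials, i.e. functions on $U$ with $$\eta_x = x z_y,\quad \eta_y = x\frac{z_x}{z^2}+\frac1z-x^2,\qquad \xi_x=-y z_y+z-y^2,\quad \xi_y=-y\frac{z_x}{z^2}.$$ Put $$x'=\frac{xz}{x^2z+1},\qquad y'=\eta,\qquad z'=\frac{(x^2z+1)^2}{z},$$ and $$x^*=\xi,\qquad y^*=\frac{y}{y^2+z},\qquad z^*=\frac{z}{(y^2+z)^2}.$$ Then $z'$, regarded as a function of $(x',y')$, and $z^*$, regarded as a function of $(x^*,y^* )$, are solutions of the constant astigmatism equation as well, i.e. $$z'_{y'y'}+(1/z')_{x'x'}+2=0,\qquad z^*_{y^*y^*}+(1/z^* )_{x^*x^*}+2=0,$$ on any open subset of $U$ on which $(x,y)\mapsto(x',y')$, respectively $(x,y)\mapsto(x^*,y^* )$, is a diffeomorphism onto its image.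
   Context: The systems defining $\xi$ and $\eta$ are compatible because $z$ solves the constant astigmatism equation; each potential is determined up to an additive constant, and the statement holds for every choice of these constants. *)

(* Defs.v *)
From Stdlib Require Export Reals.
From Coquelicot Require Export Coquelicot.
Open Scope R_scope.

(* [ex_diff_n f n x y] asks for continuous iterated partial derivatives up to
   order [n] at [(x, y)]; only used with [U] open, where this is C^oo on [U]. *)
Definition smooth_on (U : R * R -> Prop) (f : R -> R -> R) : Prop :=
  forall (n : nat) (x y : R), U (x, y) -> ex_diff_n f n x y.

(* [Derive_n] is total; smoothness and nonvanishing make all the derivatives
   in the equation genuine ones. *)
Definition constant_astigmatism_solution (U : R * R -> Prop) (z : R -> R -> R) : Prop :=
  smooth_on U z /\
  (forall x y : R, U (x, y) -> z x y <> 0) /\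
  (forall x y : R, U (x, y) ->
     partial_derive 0 2 z x y
     + partial_derive 2 0 (fun s t => 1 / z s t) x y + 2 = 0).

Definition unit_itv (t : R) : Prop := 0 <= t <= 1.

Definition path_in (U : R * R -> Prop) (g : R -> R * R) : Prop :=
  continuous_on unit_itv g /\ (forall t : R, unit_itv t -> U (g t)).

Definition path_connected (U : R * R -> Prop) : Prop :=
  forall p q : R * R, U p -> U q ->
    exists g : R -> R * R, path_in U g /\ g 0 = p /\ g 1 = q.

(* [H (s, .)] is the loop at stage [s] of a homotopy with fixed base point. *)
Definition null_homotopic (U : R * R -> Prop) (g : R -> R * R) : Prop :=
  exists H : R * R -> R * R,
    continuous_on (fun p : R * R => unit_itv (fst p) /\ unit_itv (snd p)) H /\
    (forall s t : R, unit_itv s -> unit_itv t -> U (H (s, t))) /\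
    (forall t : R, unit_itv t -> H (0, t) = g t /\ H (1, t) = g 0) /\
    (forall s : R, unit_itv s -> H (s, 0) = g 0 /\ H (s, 1) = g 0).

Definition simply_connected (U : R * R -> Prop) : Prop :=
  path_connected U /\
  (forall g : R -> R * R, path_in U g -> g 0 = g 1 -> null_homotopic U g).

Definition image2 (V : R * R -> Prop) (F1 F2 : R -> R -> R) (q : R * R) : Prop :=
  exists x y : R, V (x, y) /\ q = (F1 x y, F2 x y).

Definition diffeo_onto_image (V : R * R -> Prop) (F1 F2 : R -> R -> R) : Prop :=
  smooth_on V F1 /\ smooth_on V F2 /\
  open (image2 V F1 F2) /\
  exists G1 G2 : R -> R -> R,
    smooth_on (image2 V F1 F2) G1 /\ smooth_on (image2 V F1 F2) G2 /\
    (forall x y : R, V (x, y) ->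
       G1 (F1 x y) (F2 x y) = x /\ G2 (F1 x y) (F2 x y) = y).

(* [Z] is [w] regarded as a function of the coordinates [(F1, F2)] on [V]; the
   values of [Z] off the image of [V] are unconstrained. *)
Definition expressed_in (V : R * R -> Prop) (F1 F2 w Z : R -> R -> R) : Prop :=
  forall x y : R, V (x, y) -> Z (F1 x y) (F2 x y) = w x y.

Definition eta_potential (U : R * R -> Prop) (z eta : R -> R -> R) : Prop :=
  forall x y : R, U (x, y) ->
    is_derive (fun s => eta s y) x (x * partial_derive 0 1 z x y) /\
    is_derive (fun t => eta x t) y
      (x * (partial_derive 1 0 z x y / (z x y) ^ 2) + 1 / z x y - x ^ 2).

Definition xi_potential (U : R * R -> Prop) (z xi : R -> R -> R) : Prop :=
  forall x y : R, U (x, y) ->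
    is_derive (fun s => xi s y) x (- y * partial_derive 0 1 z x y + z x y - y ^ 2) /\
    is_derive (fun t => xi x t) y (- y * (partial_derive 1 0 z x y / (z x y) ^ 2)).

(* Main.v *)
Require Import Defs.
From Stdlib Require Import Reals Lra Lia.
From Coquelicot Require Import Coquelicot.
Open Scope R_scope.

(** The coordinate change [F = (x', eta)] has a nonvanishing Jacobian, so the derivatives
    of [Z], pulled back along [F], are found by solving the 2x2 linear system given by the
    chain rule; since the derivatives of [eta] are known in terms of [z], [z_x], [z_y], two
    such steps express the transformed equation through [x] and the 2-jet of [z], where it
    becomes a rational identity modulo the equation for [z]. The second transformation is
    the conjugate of the first by the symmetry [z(x, y) -> 1 / z(y, x)] of the equation,
    which exchanges [xi] and [eta]. *)

(** * Functions of class C^n on an open set *)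

Definition Dx (f : R -> R -> R) (x y : R) : R := Derive (fun s => f s y) x.
Definition Dy (f : R -> R -> R) (x y : R) : R := Derive (fun t => f x t) y.

(** [smooth_on U f] unfolds to [C_on n U f] for every [n]; fixing the order allows the closure
    properties to be proved by induction on it. *)
Definition C_on (n : nat) (U : R * R -> Prop) (f : R -> R -> R) : Prop :=
  forall x y : R, U (x, y) -> ex_diff_n f n x y.

Lemma open_locally_2d (U : R * R -> Prop) (x y : R) :
  open U -> U (x, y) -> locally_2d (fun u v => U (u, v)) x y.
Proof.
intros HU Hxy. apply locally_2d_locally.
generalize (HU _ Hxy). apply filter_imp. now intros [u v].
Qed.

Section C_on.

Context (U : R * R -> Prop) (HU : open U).

Lemma C_on_S (n : nat) (f : R -> R -> R) :
  C_on (S n) U f <->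
  ((forall x y, U (x, y) -> continuity_2d_pt f x y /\
      is_derive (fun s => f s y) x (Dx f x y) /\ is_derive (fun t => f x t) y (Dy f x y)) /\
   C_on n U (Dx f) /\ C_on n U (Dy f)).
Proof.
split.
- intros H. split; [|split; intros x y Hxy; now apply H].
  intros x y Hxy. destruct (H x y Hxy) as (Hc & Hx & Hy & _).
  split; [exact Hc|]. split; apply Derive_correct; assumption.
- intros (H & H1 & H2) x y Hxy. destruct (H x y Hxy) as (Hc & Hx & Hy).
  split; [exact Hc|].
  split; [eexists; exact Hx|]. split; [eexists; exact Hy|].
  split; [now apply H1|now apply H2].
Qed.

Lemma C_on_le (m n : nat) (f : R -> R -> R) : (m <= n)%nat -> C_on n U f -> C_on m U f.
Proof. intros Hmn H x y Hxy. apply ex_diff_n_m with n; auto. Qed.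

Lemma C_on_continuity (n : nat) (f : R -> R -> R) (x y : R) :
  C_on n U f -> U (x, y) -> continuity_2d_pt f x y.
Proof. intros H Hxy. destruct n; exact (proj1 (H x y Hxy)). Qed.

Lemma C_on_ext (n : nat) (f g : R -> R -> R) :
  (forall x y, U (x, y) -> f x y = g x y) -> C_on n U f -> C_on n U g.
Proof.
intros Hfg H x y Hxy. apply ex_diff_n_ext_loc with f; [|now apply H].
generalize (open_locally_2d U x y HU Hxy). apply locally_2d_impl.
apply locally_2d_forall. exact Hfg.
Qed.

(** The partial derivatives may be supplied as formulas [f1], [f2]: these agree with [Dx f], [Dy f]
    on all of the open set [U], so the C^n property passes from the former to the latter. *)
Lemma C_on_S_intro (n : nat) (f f1 f2 : R -> R -> R) :
  (forall x y, U (x, y) -> continuity_2d_pt f x y) ->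
  (forall x y, U (x, y) -> is_derive (fun s => f s y) x (f1 x y)) ->
  (forall x y, U (x, y) -> is_derive (fun t => f x t) y (f2 x y)) ->
  C_on n U f1 -> C_on n U f2 -> C_on (S n) U f.
Proof.
intros Hc H1 H2 C1 C2. apply C_on_S. split; [|split].
- intros x y Hxy. split; [now apply Hc|].
  split; apply Derive_correct; eexists; [now apply H1|now apply H2].
- revert C1. apply C_on_ext. intros x y Hxy. symmetry. now apply is_derive_unique, H1.
- revert C2. apply C_on_ext. intros x y Hxy. symmetry. now apply is_derive_unique, H2.
Qed.

Lemma C_on_const (n : nat) (c : R) : C_on n U (fun _ _ => c).
Proof.
revert c. induction n as [|n IH]; intros c.
- intros x y _. split; [apply continuity_2d_pt_const|exact I].
- apply C_on_S_intro with (fun _ _ => 0) (fun _ _ => 0); auto;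
    intros x y _; [apply continuity_2d_pt_const| |]; apply @is_derive_const.
Qed.

Lemma C_on_fst (n : nat) : C_on n U (fun x _ => x).
Proof.
destruct n as [|n].
- intros x y _. split; [apply continuity_2d_pt_id1|exact I].
- apply C_on_S_intro with (fun _ _ => 1) (fun _ _ => 0); try apply C_on_const;
    intros x y _; [apply continuity_2d_pt_id1|apply @is_derive_id|apply @is_derive_const].
Qed.

Lemma C_on_plus (n : nat) (f g : R -> R -> R) :
  C_on n U f -> C_on n U g -> C_on n U (fun x y => f x y + g x y).
Proof.
revert f g. induction n as [|n IH]; intros f g Hf Hg.
- intros x y Hxy. split; [|exact I].
  apply continuity_2d_pt_plus; eapply C_on_continuity; eassumption.
- assert (Hf' := Hf). assert (Hg' := Hg).
  apply C_on_S in Hf. apply C_on_S in Hg.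
  destruct Hf as (Hf & Hf1 & Hf2). destruct Hg as (Hg & Hg1 & Hg2).
  apply C_on_S_intro with (fun x y => Dx f x y + Dx g x y) (fun x y => Dy f x y + Dy g x y).
  + intros x y Hxy. apply continuity_2d_pt_plus; eapply C_on_continuity; eassumption.
  + intros x y Hxy. apply @is_derive_plus; [apply Hf|apply Hg]; exact Hxy.
  + intros x y Hxy. apply @is_derive_plus; [apply Hf|apply Hg]; exact Hxy.
  + now apply IH.
  + now apply IH.
Qed.

Lemma C_on_mult (n : nat) (f g : R -> R -> R) :
  C_on n U f -> C_on n U g -> C_on n U (fun x y => f x y * g x y).
Proof.
revert f g. induction n as [|n IH]; intros f g Hf Hg.
- intros x y Hxy. split; [|exact I].
  apply continuity_2d_pt_mult; eapply C_on_continuity; eassumption.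
- assert (Hf' := Hf). assert (Hg' := Hg).
  apply C_on_S in Hf. apply C_on_S in Hg.
  destruct Hf as (Hf & Hf1 & Hf2). destruct Hg as (Hg & Hg1 & Hg2).
  assert (Hf0 : C_on n U f) by (apply C_on_le with (S n); auto).
  assert (Hg0 : C_on n U g) by (apply C_on_le with (S n); auto).
  apply C_on_S_intro with (fun x y => Dx f x y * g x y + f x y * Dx g x y)
    (fun x y => Dy f x y * g x y + f x y * Dy g x y).
  + intros x y Hxy. apply continuity_2d_pt_mult; eapply C_on_continuity; eassumption.
  + intros x y Hxy. apply (is_derive_mult (fun s => f s y) (fun s => g s y));
      [apply Hf|apply Hg|exact Rmult_comm]; exact Hxy.
  + intros x y Hxy. apply (is_derive_mult (fun t => f x t) (fun t => g x t));
      [apply Hf|apply Hg|exact Rmult_comm]; exact Hxy.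
  + apply C_on_plus; now apply IH.
  + apply C_on_plus; now apply IH.
Qed.

(** The derivative of 1/f is -f' (1/f)^2, which involves no inverse other than 1/f itself, and this
    is C^n by the induction hypothesis. *)
Lemma C_on_inv (n : nat) (f : R -> R -> R) :
  (forall x y, U (x, y) -> f x y <> 0) -> C_on n U f -> C_on n U (fun x y => / f x y).
Proof.
intros H0. induction n as [|n IH]; intros Hf.
- intros x y Hxy. split; [|exact I].
  apply continuity_2d_pt_inv; [eapply C_on_continuity; eassumption|auto].
- assert (Hi : C_on n U (fun x y => / f x y))
    by (apply IH; apply C_on_le with (S n); auto).
  assert (Hf' := Hf). apply C_on_S in Hf. destruct Hf as (Hf & Hf1 & Hf2).
  apply C_on_S_intro with (fun x y => (-1 * Dx f x y) * (/ f x y * / f x y))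
    (fun x y => (-1 * Dy f x y) * (/ f x y * / f x y)).
  + intros x y Hxy.
    apply continuity_2d_pt_inv; [eapply C_on_continuity; eassumption|auto].
  + intros x y Hxy. specialize (H0 x y Hxy).
    replace (-1 * Dx f x y * (/ f x y * / f x y)) with (- Dx f x y / f x y ^ 2)
      by now field.
    apply (is_derive_inv (fun s => f s y)); [now apply Hf|exact H0].
  + intros x y Hxy. specialize (H0 x y Hxy).
    replace (-1 * Dy f x y * (/ f x y * / f x y)) with (- Dy f x y / f x y ^ 2)
      by now field.
    apply (is_derive_inv (fun t => f x t)); [now apply Hf|exact H0].
  + repeat apply C_on_mult; auto. apply C_on_const.
  + repeat apply C_on_mult; auto. apply C_on_const.
Qed.

(** Continuity of [Dx f] upgrades the existence of partial derivatives to total differentiability,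
    from which the chain rule follows. *)
Lemma C_on_chain (f : R -> R -> R) (a b : R -> R) (t a' b' : R) :
  C_on 1 U f -> U (a t, b t) -> is_derive a t a' -> is_derive b t b' ->
  is_derive (fun t => f (a t) (b t)) t (Dx f (a t) (b t) * a' + Dy f (a t) (b t) * b').
Proof.
intros Hf Ht Ha Hb. apply C_on_S in Hf. destruct Hf as (Hf & Hf1 & _).
apply is_derive_Reals. apply derivable_pt_lim_comp_2d; try now apply is_derive_Reals.
apply filterdiff_differentiable_pt_lim.
apply (is_derive_filterdiff f (a t) (b t) (Dx f)).
- generalize (HU _ Ht). apply filter_imp. intros [u v] Huv. now apply Hf.
- now apply Hf.
- apply continuity_2d_pt_filterlim. apply Hf1. exact Ht.
Qed.

End C_on.

(** The chain rule puts [Dx f] and [Dy f] in place of [f] with the same inner functions, so the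
    induction on [n] is over all [f]. *)
Lemma C_on_comp (V U : R * R -> Prop) (n : nat) (f g1 g2 : R -> R -> R) :
  open V -> open U -> (forall x y, V (x, y) -> U (g1 x y, g2 x y)) ->
  C_on n U f -> C_on n V g1 -> C_on n V g2 ->
  C_on n V (fun x y => f (g1 x y) (g2 x y)).
Proof.
intros HV HU HVU.
assert (Hcont : forall m h, C_on m U h -> C_on m V g1 -> C_on m V g2 ->
  forall x y, V (x, y) -> continuity_2d_pt (fun x y => h (g1 x y) (g2 x y)) x y).
{ intros m h Hh H1 H2 x y Hxy. apply continuity_2d_pt_filterlim.
  apply (continuous_comp_2 (fun p : R * R => g1 (fst p) (snd p))
           (fun p : R * R => g2 (fst p) (snd p)) h (x, y)).
  - apply (continuity_2d_pt_filterlim g1 x y). eapply C_on_continuity; eassumption.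
  - apply (continuity_2d_pt_filterlim g2 x y). eapply C_on_continuity; eassumption.
  - apply (continuity_2d_pt_filterlim h).
    eapply C_on_continuity; [eassumption|exact (HVU x y Hxy)]. }
revert f. induction n as [|n IH]; intros f Hf H1 H2.
- intros x y Hxy. split; [|exact I]. now apply (Hcont 0%nat f).
- assert (Hf1 : C_on 1 U f) by (apply C_on_le with (S n); auto; lia).
  assert (H1n : C_on n V g1) by (apply C_on_le with (S n); auto).
  assert (H2n : C_on n V g2) by (apply C_on_le with (S n); auto).
  assert (Hc := Hcont (S n) f Hf H1 H2).
  apply C_on_S in H1. apply C_on_S in H2. apply C_on_S in Hf.
  destruct H1 as (G1 & H11 & H12), H2 as (G2 & H21 & H22), Hf as (_ & Hd1 & Hd2).
  apply C_on_S_intro with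
    (fun x y => Dx f (g1 x y) (g2 x y) * Dx g1 x y + Dy f (g1 x y) (g2 x y) * Dx g2 x y)
    (fun x y => Dx f (g1 x y) (g2 x y) * Dy g1 x y + Dy f (g1 x y) (g2 x y) * Dy g2 x y);
    auto.
  + intros x y Hxy.
    apply (C_on_chain U HU f (fun s => g1 s y) (fun s => g2 s y)); auto;
      [now apply G1|now apply G2].
  + intros x y Hxy.
    apply (C_on_chain U HU f (fun t => g1 x t) (fun t => g2 x t)); auto;
      [now apply G1|now apply G2].
  + apply C_on_plus; auto; apply C_on_mult; auto.
  + apply C_on_plus; auto; apply C_on_mult; auto.
Qed.

(** * Derivatives in new coordinates *)

(** The relation Z(F1, F2) = w holds on the open set [V], hence near the point along both coordinate
    lines, where both sides can be differentiated. *)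
Lemma expressed_in_chain (V : R * R -> Prop) (F1 F2 w Z : R -> R -> R)
  (x y a b c d wx wy : R) :
  open V -> open (image2 V F1 F2) -> C_on 1 (image2 V F1 F2) Z ->
  expressed_in V F1 F2 w Z -> V (x, y) ->
  is_derive (fun s => F1 s y) x a -> is_derive (fun t => F1 x t) y b ->
  is_derive (fun s => F2 s y) x c -> is_derive (fun t => F2 x t) y d ->
  is_derive (fun s => w s y) x wx -> is_derive (fun t => w x t) y wy ->
  wx = Dx Z (F1 x y) (F2 x y) * a + Dy Z (F1 x y) (F2 x y) * c /\
  wy = Dx Z (F1 x y) (F2 x y) * b + Dy Z (F1 x y) (F2 x y) * d.
Proof.
intros HV HI HZ Hw Hxy Ha Hb Hc Hd Hwx Hwy.
assert (HIxy : image2 V F1 F2 (F1 x y, F2 x y)) by (exists x, y; auto).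
pose proof (C_on_chain _ HI Z (fun s => F1 s y) (fun s => F2 s y) x a c HZ HIxy Ha Hc) as Zx.
pose proof (C_on_chain _ HI Z (fun t => F1 x t) (fun t => F2 x t) y b d HZ HIxy Hb Hd) as Zy.
assert (HV2 := open_locally_2d V x y HV Hxy).
split; [rewrite <- (is_derive_unique _ _ _ Hwx)|rewrite <- (is_derive_unique _ _ _ Hwy)];
  apply is_derive_unique.
- refine (is_derive_ext_loc _ _ _ _ _ Zx).
  generalize (locally_2d_1d_const_y _ _ _ HV2). apply filter_imp. intros s. apply Hw.
- refine (is_derive_ext_loc _ _ _ _ _ Zy).
  generalize (locally_2d_1d_const_x _ _ _ HV2). apply filter_imp. intros t. apply Hw.
Qed.

(** The components of the inverse map are the coordinate functions x and y expressed in (F1, F2);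
    the chain rule for them says that DG DF is the identity matrix. *)
Lemma diffeo_jacobian (V : R * R -> Prop) (F1 F2 : R -> R -> R) (x y a b c d : R) :
  open V -> diffeo_onto_image V F1 F2 -> V (x, y) ->
  is_derive (fun s => F1 s y) x a -> is_derive (fun t => F1 x t) y b ->
  is_derive (fun s => F2 s y) x c -> is_derive (fun t => F2 x t) y d ->
  a * d - b * c <> 0.
Proof.
intros HV (_ & _ & HI & G1 & G2 & S1 & S2 & HG) Hxy Ha Hb Hc Hd HJ.
destruct (expressed_in_chain V F1 F2 (fun s _ => s) G1 x y a b c d 1 0) as [E1x E1y];
  auto; try exact (S1 1%nat); try apply @is_derive_id; try apply @is_derive_const.
{ intros s t Hst. now apply HG. }
destruct (expressed_in_chain V F1 F2 (fun _ t => t) G2 x y a b c d 0 1) as [E2x E2y];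
  auto; try exact (S2 1%nat); try apply @is_derive_id; try apply @is_derive_const.
{ intros s t Hst. now apply HG. }
apply R1_neq_R0.
(* The Jacobian determinants of [G] and [F] have product 1. *)
transitivity ((Dx G1 (F1 x y) (F2 x y) * Dy G2 (F1 x y) (F2 x y)
  - Dy G1 (F1 x y) (F2 x y) * Dx G2 (F1 x y) (F2 x y)) * (a * d - b * c)).
- transitivity (1 * 1 - 0 * 0); [ring|].
  (* The entries 1, 1, 0, 0 of the identity matrix are replaced in turn by their chain-rule
     expressions; multiplicativity of the 2x2 determinant remains. *)
  rewrite E1x at 1. rewrite E2y at 1. rewrite E1y at 1. rewrite E2x at 1. ring.
- rewrite HJ. ring.
Qed.

(** Cramer's rule for the linear system of [expressed_in_chain]. *)
Lemma expressed_in_derivatives (V : R * R -> Prop) (F1 F2 w Z : R -> R -> R)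
  (x y a b c d wx wy : R) :
  open V -> open (image2 V F1 F2) -> C_on 1 (image2 V F1 F2) Z ->
  expressed_in V F1 F2 w Z -> V (x, y) ->
  is_derive (fun s => F1 s y) x a -> is_derive (fun t => F1 x t) y b ->
  is_derive (fun s => F2 s y) x c -> is_derive (fun t => F2 x t) y d ->
  is_derive (fun s => w s y) x wx -> is_derive (fun t => w x t) y wy ->
  a * d - b * c <> 0 ->
  Dx Z (F1 x y) (F2 x y) = (d * wx - c * wy) / (a * d - b * c) /\
  Dy Z (F1 x y) (F2 x y) = (a * wy - b * wx) / (a * d - b * c).
Proof.
intros HV HI HZ Hw Hxy Ha Hb Hc Hd Hwx Hwy HJ.
destruct (expressed_in_chain V F1 F2 w Z x y a b c d wx wy) as [Ex Ey]; auto.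
rewrite Ex, Ey. split; field; exact HJ.
Qed.

(** * Smooth functions on open sets *)

Lemma smooth_on_d (U : R * R -> Prop) (f : R -> R -> R) :
  open U -> smooth_on U f -> smooth_on U (Dx f) /\ smooth_on U (Dy f).
Proof.
intros HU Hf. split; intros n; apply (proj1 (C_on_S U n f) (Hf (S n))).
Qed.

Lemma smooth_on_is_derive (U : R * R -> Prop) (f : R -> R -> R) (x y : R) :
  smooth_on U f -> U (x, y) ->
  is_derive (fun s => f s y) x (Dx f x y) /\ is_derive (fun t => f x t) y (Dy f x y).
Proof. intros Hf Hxy. now apply (proj1 (C_on_S U 0 f) (Hf 1%nat)). Qed.

Lemma smooth_on_mixed (U : R * R -> Prop) (f : R -> R -> R) (x y : R) :
  open U -> smooth_on U f -> U (x, y) -> Dx (Dy f) x y = Dy (Dx f) x y.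
Proof.
intros HU Hf Hxy. destruct (smooth_on_d U f HU Hf) as [H1 H2].
apply Schwarz.
- generalize (open_locally_2d U x y HU Hxy). apply locally_2d_impl, locally_2d_forall.
  intros u v Huv.
  destruct (smooth_on_is_derive U f u v Hf Huv) as [A B].
  split; [eexists; exact A|]. split; [eexists; exact B|].
  split; eexists; [apply (smooth_on_is_derive U (Dy f) u v H2 Huv)
                  |apply (smooth_on_is_derive U (Dx f) u v H1 Huv)].
- apply (C_on_continuity U 0 (Dx (Dy f))); [|exact Hxy].
  exact (proj1 (smooth_on_d U (Dy f) HU H2) 0%nat).
- apply (C_on_continuity U 0 (Dy (Dx f))); [|exact Hxy].
  exact (proj2 (smooth_on_d U (Dx f) HU H1) 0%nat).
Qed.

(** On the open image, [Z] coincides with w(G1, G2), a composition of smooth functions; its values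
    elsewhere do not affect the derivatives there. *)
Lemma smooth_on_expressed_in (V : R * R -> Prop) (F1 F2 w Z : R -> R -> R) :
  open V -> diffeo_onto_image V F1 F2 -> smooth_on V w -> expressed_in V F1 F2 w Z ->
  smooth_on (image2 V F1 F2) Z.
Proof.
intros HV (_ & _ & HI & G1 & G2 & S1 & S2 & HG) Hw HZ n.
apply (C_on_ext _ HI n (fun p q => w (G1 p q) (G2 p q))).
- intros p q (x & y & Hxy & E). injection E as -> ->.
  destruct (HG x y Hxy) as [-> ->]. symmetry. now apply HZ.
- apply C_on_comp with V; auto; [|exact (Hw n)|exact (S1 n)|exact (S2 n)].
  intros p q (x & y & Hxy & E). injection E as -> ->.
  now destruct (HG x y Hxy) as [-> ->].
Qed.

Lemma smooth_on_inv (U : R * R -> Prop) (f : R -> R -> R) :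
  open U -> (forall x y, U (x, y) -> f x y <> 0) -> smooth_on U f ->
  smooth_on U (fun x y => 1 / f x y).
Proof.
intros HU H0 Hf n. apply (C_on_mult U HU n (fun _ _ => 1) (fun x y => / f x y)).
- now apply C_on_const.
- apply C_on_inv; auto. exact (Hf n).
Qed.

Lemma Dx_ext (U : R * R -> Prop) (f g : R -> R -> R) (x y : R) :
  open U -> (forall u v, U (u, v) -> f u v = g u v) -> U (x, y) -> Dx f x y = Dx g x y.
Proof.
intros HU H Hxy. apply Derive_ext_loc.
generalize (locally_2d_1d_const_y _ _ _ (open_locally_2d U x y HU Hxy)).
apply filter_imp. intros s. apply H.
Qed.

(** * The first transformation *)

(** The function under [Derive] left by [auto_derive] is only convertible to the one in the
    hypothesis; [change] fails on a mismatch, and [match] then tries another hypothesis. *)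
Ltac rewrite_derive :=
  repeat match goal with
  | H : is_derive ?f ?x ?l |- context [Derive ?g ?x] =>
      change (Derive g x) with (Derive f x); rewrite (is_derive_unique f x l H)
  end.

Ltac derive_poly :=
  auto_derive;
  [repeat match goal with |- _ /\ _ => split end;
   try exact Logic.I; eexists; eassumption
  | rewrite_derive; ring].

(** Carrying out the derivatives of 1/z gives an equation in the 2-jet of [z] that can be solved for
    z_yy. *)
Lemma solution_expanded (U : R * R -> Prop) (z : R -> R -> R) (x y : R) :
  open U -> constant_astigmatism_solution U z -> U (x, y) ->
  Dy (Dy z) x y + (2 * Dx z x y ^ 2 / z x y ^ 3 - Dx (Dx z) x y / z x y ^ 2) + 2 = 0.
Proof.
intros HU (Hz & H0 & Heq) Hxy.
rewrite <- (Heq x y Hxy). f_equal. f_equal.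
change (partial_derive 2 0 (fun s t => 1 / z s t) x y)
  with (Dx (Dx (fun s t => 1 / z s t)) x y).
destruct (smooth_on_d U z HU Hz) as [Hz1 _].
(* The inner derivative (1/z)_x is replaced by its closed form on the whole of [U], so that it can
   be differentiated once more. *)
rewrite (Dx_ext U (Dx (fun s t => 1 / z s t)) (fun u v => - Dx z u v / z u v ^ 2) x y); auto.
- symmetry. apply is_derive_unique.
  destruct (smooth_on_is_derive U z x y Hz Hxy) as [A _].
  destruct (smooth_on_is_derive U (Dx z) x y Hz1 Hxy) as [A' _].
  specialize (H0 x y Hxy).
  auto_derive.
  + split; [eexists; exact A'|]. split; [eexists; exact A|].
    split; [|exact Logic.I]. rewrite Rmult_1_r. now apply Rmult_integral_contrapositive.
  + rewrite_derive. now field.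
- intros u v Huv. apply is_derive_unique.
  destruct (smooth_on_is_derive U z u v Hz Huv) as [A _].
  specialize (H0 u v Huv).
  auto_derive.
  + split; [eexists; exact A|]. now split.
  + rewrite_derive. now field.
Qed.

Section Transform.

Context (V : R * R -> Prop) (z X eta Z : R -> R -> R).

Let W := fun x y : R => (x ^ 2 * z x y + 1) ^ 2 / z x y.
Let zx := Dx z.
Let zy := Dy z.

(* The Jacobian of [F = (X, eta)] is [Q / (z^2 D^2)], the derivatives of [W] are
   [D M / z^2] and [z_y D (D - 2) / z^2], and the pullbacks along [F] of [Z_q] and
   [(1/Z)_p] are [A / Q] and [B / (D Q)]; the suffixes [1], [2] stand for the partial
   derivatives in [x] and [y]. *)
Let D := fun x y : R => x ^ 2 * z x y + 1.
Let D1 := fun x y : R => 2 * x * z x y + x ^ 2 * zx x y.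
Let D2 := fun x y : R => x ^ 2 * zy x y.
Let P := fun x y : R => z x y + x * zx x y - x ^ 2 * z x y ^ 2.
Let P1 := fun x y : R =>
  2 * zx x y + x * Dx zx x y - 2 * x * z x y ^ 2 - 2 * x ^ 2 * z x y * zx x y.
Let P2 := fun x y : R => zy x y + x * Dx zy x y - 2 * x ^ 2 * z x y * zy x y.
Let Q := fun x y : R => P x y ^ 2 - x ^ 2 * z x y ^ 2 * zy x y ^ 2.
Let Q1 := fun x y : R => 2 * P x y * P1 x y
  - (2 * x * z x y ^ 2 * zy x y ^ 2 + 2 * x ^ 2 * z x y * zx x y * zy x y ^ 2
     + 2 * x ^ 2 * z x y ^ 2 * zy x y * Dx zy x y).
Let Q2 := fun x y : R => 2 * P x y * P2 x y
  - (2 * x ^ 2 * z x y * zy x y ^ 3 + 2 * x ^ 2 * z x y ^ 2 * zy x y * Dy zy x y).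
Let M := fun x y : R => 4 * x * z x y ^ 2 + zx x y * (D x y - 2).
Let M1 := fun x y : R =>
  4 * z x y ^ 2 + 8 * x * z x y * zx x y + Dx zx x y * (D x y - 2) + zx x y * D1 x y.
Let M2 := fun x y : R =>
  8 * x * z x y * zy x y + Dx zy x y * (D x y - 2) + zx x y * D2 x y.
Let A := fun x y : R => - zy x y * D x y ^ 3 * z x y.
Let A1 := fun x y : R => - Dx zy x y * D x y ^ 3 * z x y
  - 3 * zy x y * D x y ^ 2 * D1 x y * z x y - zy x y * D x y ^ 3 * zx x y.
Let A2 := fun x y : R => - Dy zy x y * D x y ^ 3 * z x y
  - 3 * zy x y * D x y ^ 2 * D2 x y * z x y - zy x y * D x y ^ 3 * zy x y.
Let B := fun x y : R => x * z x y ^ 2 * zy x y ^ 2 * (D x y - 2) - P x y * M x y.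
Let B1 := fun x y : R => z x y ^ 2 * zy x y ^ 2 * (D x y - 2)
  + 2 * x * z x y * zx x y * zy x y ^ 2 * (D x y - 2)
  + 2 * x * z x y ^ 2 * zy x y * Dx zy x y * (D x y - 2)
  + x * z x y ^ 2 * zy x y ^ 2 * D1 x y - P1 x y * M x y - P x y * M1 x y.
Let B2 := fun x y : R => 2 * x * z x y * zy x y ^ 3 * (D x y - 2)
  + 2 * x * z x y ^ 2 * zy x y * Dy zy x y * (D x y - 2)
  + x * z x y ^ 2 * zy x y ^ 2 * D2 x y - P2 x y * M x y - P x y * M2 x y.

(** [X] is tied to its formula by a hypothesis on [V], so that the section also applies to the
    second transformation, where the formula holds only after some algebra. *)
Context (HV : open V) (Hpos : forall x y, V (x, y) -> 0 < z x y)
  (Hz : constant_astigmatism_solution V z) (Heta : eta_potential V z eta)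
  (HX : forall x y, V (x, y) -> X x y = x * z x y / (x ^ 2 * z x y + 1))
  (HF : diffeo_onto_image V X eta) (HZ : expressed_in V X eta W Z).

(** * Derivatives of the auxiliary expressions *)

Lemma D_pos x y : V (x, y) -> 0 < D x y.
Proof. intros Hxy. specialize (Hpos x y Hxy). unfold D. nra. Qed.

(** Both mixed derivatives are recorded as [Dx zy], so that later identities contain a single symbol
    for z_xy. *)
Lemma z_derivatives x y : V (x, y) ->
  is_derive (fun s => z s y) x (zx x y) /\ is_derive (fun t => z x t) y (zy x y) /\
  is_derive (fun s => zx s y) x (Dx zx x y) /\ is_derive (fun t => zx x t) y (Dx zy x y) /\
  is_derive (fun s => zy s y) x (Dx zy x y) /\ is_derive (fun t => zy x t) y (Dy zy x y).
Proof.
intros Hxy. assert (Hs := proj1 Hz). destruct (smooth_on_d V z HV Hs) as [H1 H2].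
assert (Hmix := smooth_on_mixed V z x y HV Hs Hxy). fold zx zy in Hmix, H1, H2.
destruct (smooth_on_is_derive V z x y Hs Hxy).
destruct (smooth_on_is_derive V zx x y H1 Hxy) as [? Hzxy].
destruct (smooth_on_is_derive V zy x y H2 Hxy).
rewrite <- Hmix in Hzxy. auto 10.
Qed.

Lemma D_derivatives x y : V (x, y) ->
  is_derive (fun s => D s y) x (D1 x y) /\ is_derive (fun t => D x t) y (D2 x y).
Proof.
intros Hxy. destruct (z_derivatives x y Hxy) as (? & ? & ? & ? & ? & ?).
unfold D, D1, D2. split; derive_poly.
Qed.

Lemma P_derivatives x y : V (x, y) ->
  is_derive (fun s => P s y) x (P1 x y) /\ is_derive (fun t => P x t) y (P2 x y).
Proof.
intros Hxy. destruct (z_derivatives x y Hxy) as (? & ? & ? & ? & ? & ?).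
unfold P, P1, P2. split; derive_poly.
Qed.

Lemma Q_derivatives x y : V (x, y) ->
  is_derive (fun s => Q s y) x (Q1 x y) /\ is_derive (fun t => Q x t) y (Q2 x y).
Proof.
intros Hxy. destruct (z_derivatives x y Hxy) as (? & ? & ? & ? & ? & ?).
destruct (P_derivatives x y Hxy).
unfold Q, Q1, Q2. split; derive_poly.
Qed.

Lemma M_derivatives x y : V (x, y) ->
  is_derive (fun s => M s y) x (M1 x y) /\ is_derive (fun t => M x t) y (M2 x y).
Proof.
intros Hxy. destruct (z_derivatives x y Hxy) as (? & ? & ? & ? & ? & ?).
destruct (D_derivatives x y Hxy).
unfold M, M1, M2. split; derive_poly.
Qed.

Lemma A_derivatives x y : V (x, y) ->
  is_derive (fun s => A s y) x (A1 x y) /\ is_derive (fun t => A x t) y (A2 x y).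
Proof.
intros Hxy. destruct (z_derivatives x y Hxy) as (? & ? & ? & ? & ? & ?).
destruct (D_derivatives x y Hxy).
unfold A, A1, A2. split; derive_poly.
Qed.

Lemma B_derivatives x y : V (x, y) ->
  is_derive (fun s => B s y) x (B1 x y) /\ is_derive (fun t => B x t) y (B2 x y).
Proof.
intros Hxy. destruct (z_derivatives x y Hxy) as (? & ? & ? & ? & ? & ?).
destruct (D_derivatives x y Hxy), (P_derivatives x y Hxy), (M_derivatives x y Hxy).
unfold B, B1, B2. split; derive_poly.
Qed.

(** This is the transformed equation once the formulas of [transformed_derivatives] are applied to
    A/Q and B/(DQ), whose derivatives are written out by the quotient rule. *)
Lemma transform_identity x y :
  V (x, y) -> Q x y <> 0 ->
  z x y ^ 2 * (P x y * ((A2 x y * Q x y - A x y * Q2 x y) / Q x y ^ 2)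
    - x * zy x y * ((A1 x y * Q x y - A x y * Q1 x y) / Q x y ^ 2)) / Q x y
  + D x y ^ 2
    * (P x y * ((B1 x y * (D x y * Q x y) - B x y * (D1 x y * Q x y + D x y * Q1 x y))
                / (D x y * Q x y) ^ 2)
       - x * z x y ^ 2 * zy x y
         * ((B2 x y * (D x y * Q x y) - B x y * (D2 x y * Q x y + D x y * Q2 x y))
            / (D x y * Q x y) ^ 2)) / Q x y
  + 2 = 0.
Proof.
intros Hxy HQ0. pose proof (D_pos x y Hxy) as HD0.
pose proof (solution_expanded V z x y HV Hz Hxy) as Heq. fold zx zy in Heq.
(* The equation is solved for z_yy, which enters the goal only through [Q2], [A2] and [B2]. *)
assert (Hzz : Dy zy x y = Dx zx x y / z x y ^ 2 - 2 * zx x y ^ 2 / z x y ^ 3 - 2) by lra.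
specialize (Hpos x y Hxy).
unfold Q2, A2, B2. rewrite Hzz.
unfold A1, A, B1, B, Q1, P1, P2, M1, M2, M, D1, D2.
assert (HQ : Q x y = P x y ^ 2 - x ^ 2 * z x y ^ 2 * zy x y ^ 2) by reflexivity.
assert (HD : D x y = x ^ 2 * z x y + 1) by reflexivity.
assert (HP : P x y = z x y + x * zx x y - x ^ 2 * z x y ^ 2) by reflexivity.
clear Heq Hzz. revert HP HD HQ HQ0 HD0 Hpos.
(* The jet entries become independent real variables, and P, D, Q are eliminated through their
   defining equations; what is left is an identity of rational functions. *)
generalize (Q x y) (P x y) (D x y) (z x y) (zx x y) (zy x y) (Dx zx x y) (Dx zy x y).
intros q p d w wx wy wxx wxy -> -> -> Hq Hd Hw.
field. repeat split; lra || assumption.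
Qed.

(** * The coordinate change and its Jacobian *)

Lemma X_derivatives x y : V (x, y) ->
  is_derive (fun s => X s y) x (P x y / D x y ^ 2) /\
  is_derive (fun t => X x t) y (x * zy x y / D x y ^ 2).
Proof.
intros Hxy. destruct (z_derivatives x y Hxy) as (? & ? & _).
destruct (D_derivatives x y Hxy) as [? ?].
assert (HD : D x y <> 0) by (apply Rgt_not_eq, D_pos, Hxy).
assert (HV2 := open_locally_2d V x y HV Hxy).
split.
- apply (is_derive_ext_loc (fun s => s * z s y / D s y)).
  { generalize (locally_2d_1d_const_y _ _ _ HV2). apply filter_imp.
    intros s Hs. symmetry. now apply HX. }
  replace (P x y / D x y ^ 2) with
    (((z x y + x * zx x y) * D x y - x * z x y * D1 x y) / D x y ^ 2).
  2: { unfold P, D, D1 in *. field. exact HD. }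
  apply (is_derive_div (fun s => s * z s y) (fun s => D s y)); auto.
  derive_poly.
- apply (is_derive_ext_loc (fun t => x * z x t / D x t)).
  { generalize (locally_2d_1d_const_x _ _ _ HV2). apply filter_imp.
    intros t Ht. symmetry. now apply HX. }
  replace (x * zy x y / D x y ^ 2) with
    ((x * zy x y * D x y - x * z x y * D2 x y) / D x y ^ 2).
  2: { unfold D, D2 in *. field. exact HD. }
  apply (is_derive_div (fun t => x * z x t) (fun t => D x t)); auto.
  derive_poly.
Qed.

(** The numerators P and x z_y of the derivatives of [X] occur here again, crosswise; this is why
    the numerator Q of the Jacobian is a difference of two squares. *)
Lemma eta_derivatives x y : V (x, y) ->
  is_derive (fun s => eta s y) x (x * zy x y) /\
  is_derive (fun t => eta x t) y (P x y / z x y ^ 2).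
Proof.
intros Hxy. destruct (Heta x y Hxy) as [H1 H2]. split; [exact H1|].
replace (P x y / z x y ^ 2)
  with (x * (partial_derive 1 0 z x y / z x y ^ 2) + 1 / z x y - x ^ 2); [exact H2|].
change (partial_derive 1 0 z x y) with (zx x y).
specialize (Hpos x y Hxy). unfold P. field. lra.
Qed.

Lemma jacobian_eq x y : V (x, y) ->
  P x y / D x y ^ 2 * (P x y / z x y ^ 2) - x * zy x y / D x y ^ 2 * (x * zy x y)
  = Q x y / (z x y ^ 2 * D x y ^ 2).
Proof.
intros Hxy. pose proof (D_pos x y Hxy). specialize (Hpos x y Hxy).
unfold Q. field. split; lra.
Qed.

Lemma Q_neq_0 x y : V (x, y) -> Q x y <> 0.
Proof.
intros Hxy HQ. destruct (X_derivatives x y Hxy), (eta_derivatives x y Hxy).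
apply (diffeo_jacobian V X eta x y (P x y / D x y ^ 2) (x * zy x y / D x y ^ 2)
  (x * zy x y) (P x y / z x y ^ 2)); auto.
rewrite (jacobian_eq x y Hxy), HQ. unfold Rdiv. ring.
Qed.

(** Cramer's rule with the Jacobian Q/(z^2 D^2). The function [w] is arbitrary because the formulas
    serve at both orders: for [Z] and 1/Z, then for Z_q and (1/Z)_p. *)
Lemma transformed_derivatives (w Y : R -> R -> R) (x y wx wy : R) :
  smooth_on (image2 V X eta) Y -> expressed_in V X eta w Y -> V (x, y) ->
  is_derive (fun s => w s y) x wx -> is_derive (fun t => w x t) y wy ->
  Dx Y (X x y) (eta x y)
    = D x y ^ 2 * (P x y * wx - x * z x y ^ 2 * zy x y * wy) / Q x y /\
  Dy Y (X x y) (eta x y) = z x y ^ 2 * (P x y * wy - x * zy x y * wx) / Q x y.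
Proof.
intros HY Hw Hxy Hwx Hwy.
assert (HQ := Q_neq_0 x y Hxy).
destruct (X_derivatives x y Hxy), (eta_derivatives x y Hxy).
pose proof (D_pos x y Hxy). pose proof (Hpos x y Hxy). assert (J := jacobian_eq x y Hxy).
destruct (expressed_in_derivatives V X eta w Y x y (P x y / D x y ^ 2)
  (x * zy x y / D x y ^ 2) (x * zy x y) (P x y / z x y ^ 2) wx wy) as [-> ->]; auto.
- apply HF.
- exact (HY 1%nat).
- rewrite J. apply Rgt_not_eq in H3, H4. apply Rmult_integral_contrapositive.
  split; [exact HQ|]. apply Rinv_neq_0_compat.
  apply Rmult_integral_contrapositive. split; now apply pow_nonzero.
- rewrite J. split; field; repeat split; lra || auto.
Qed.

Lemma smooth_on_transformed : smooth_on (image2 V X eta) Z.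
Proof.
apply smooth_on_expressed_in with W; auto.
intros n. assert (HC := proj1 Hz n : C_on n V z).
assert (HD : C_on n V D).
{ apply C_on_plus; auto; [|now apply C_on_const].
  apply C_on_mult; auto. unfold pow.
  repeat apply C_on_mult; auto; (now apply C_on_fst) || now apply C_on_const. }
change (C_on n V W).
apply (C_on_mult V HV n (fun x y => D x y ^ 2) (fun x y => / z x y)).
- unfold pow. repeat apply C_on_mult; auto. now apply C_on_const.
- apply C_on_inv; auto. intros x y Hxy. now apply Rgt_not_eq, Hpos.
Qed.

Lemma W_derivatives x y : V (x, y) ->
  is_derive (fun s => W s y) x (D x y * M x y / z x y ^ 2) /\
  is_derive (fun t => W x t) y (zy x y * D x y * (D x y - 2) / z x y ^ 2).
Proof.
intros Hxy. destruct (z_derivatives x y Hxy) as (? & ? & _).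
destruct (D_derivatives x y Hxy). pose proof (Hpos x y Hxy).
split.
- replace (D x y * M x y / z x y ^ 2) with
   ((2 * D x y * D1 x y * z x y - D x y ^ 2 * zx x y) / z x y ^ 2).
  2: { unfold M, D1, D. field. lra. }
  apply (is_derive_div (fun s => D s y ^ 2) (fun s => z s y)); auto; [derive_poly|lra].
- replace (zy x y * D x y * (D x y - 2) / z x y ^ 2) with
   ((2 * D x y * D2 x y * z x y - D x y ^ 2 * zy x y) / z x y ^ 2).
  2: { unfold D2, D. field. lra. }
  apply (is_derive_div (fun t => D x t ^ 2) (fun t => z x t)); auto; [derive_poly|lra].
Qed.

Lemma expressed_in_Dy : expressed_in V X eta (fun x y => A x y / Q x y) (Dy Z).
Proof.
intros x y Hxy. destruct (W_derivatives x y Hxy) as [W1 W2].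
destruct (transformed_derivatives W Z x y _ _ smooth_on_transformed HZ Hxy W1 W2) as [_ ->].
pose proof (Hpos x y Hxy).
(* The numerator is z_y D (P (D - 2) - x M), and P (D - 2) - x M = - z D^2. *)
apply (Rmult_eq_compat_r (/ Q x y)). unfold A, M, P, D. field. lra.
Qed.

Lemma expressed_in_Dx_inv :
  expressed_in V X eta (fun x y => B x y / (D x y * Q x y)) (Dx (fun s t => 1 / Z s t)).
Proof.
intros x y Hxy. destruct (W_derivatives x y Hxy) as [W1 W2].
assert (Hne : forall u v, V (u, v) -> W u v <> 0).
{ intros u v Huv. pose proof (D_pos u v Huv). pose proof (Hpos u v Huv).
  apply Rgt_not_eq, Rdiv_lt_0_compat; [apply pow_lt|]; assumption. }
pose proof (D_pos x y Hxy). pose proof (Hpos x y Hxy). pose proof (Q_neq_0 x y Hxy).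
destruct (transformed_derivatives (fun s t => 1 / W s t) (fun s t => 1 / Z s t) x y
  (- (D x y * M x y / z x y ^ 2) / W x y ^ 2)
  (- (zy x y * D x y * (D x y - 2) / z x y ^ 2) / W x y ^ 2)) as [-> _]; auto.
- apply smooth_on_inv; [apply HF| |exact smooth_on_transformed].
  intros p q (u & v & Huv & E). injection E as -> ->. rewrite HZ; auto.
- intros u v Huv. now rewrite HZ.
- refine (is_derive_ext (fun s => / W s y) _ _ _ _ _).
  { intros s. unfold Rdiv. now rewrite Rmult_1_l. }
  apply (is_derive_inv (fun s => W s y)); auto.
- refine (is_derive_ext (fun t => / W x t) _ _ _ _ _).
  { intros t. unfold Rdiv. now rewrite Rmult_1_l. }
  apply (is_derive_inv (fun t => W x t)); auto.
(* Since W = D^2/z, the derivatives of 1/W are -M/D^3 and -z_y (D - 2)/D^3. *)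
- unfold B, W. fold (D x y). field. repeat split; auto; lra.
Qed.

Lemma transformed_solution : constant_astigmatism_solution (image2 V X eta) Z.
Proof.
split; [exact smooth_on_transformed|]. split.
{ intros p q (x & y & Hxy & E). injection E as -> ->. rewrite (HZ x y Hxy).
  apply Rgt_not_eq, Rdiv_lt_0_compat; [apply pow_lt, D_pos|apply Hpos]; assumption. }
intros p q (x & y & Hxy & E). injection E as -> ->.
change (Dy (Dy Z) (X x y) (eta x y)
        + Dx (Dx (fun s t => 1 / Z s t)) (X x y) (eta x y) + 2 = 0).
assert (HI : open (image2 V X eta)) by apply HF.
assert (SZ := smooth_on_transformed).
assert (SZi : smooth_on (image2 V X eta) (fun s t => 1 / Z s t)).
{ apply smooth_on_inv; auto.
  intros p q (u & v & Huv & E). injection E as -> ->. rewrite (HZ u v Huv).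
  apply Rgt_not_eq, Rdiv_lt_0_compat; [apply pow_lt, D_pos|apply Hpos]; assumption. }
destruct (smooth_on_d _ _ HI SZ) as [_ SZy].
destruct (smooth_on_d _ _ HI SZi) as [SZix _].
pose proof (D_pos x y Hxy). pose proof (Hpos x y Hxy). pose proof (Q_neq_0 x y Hxy).
destruct (D_derivatives x y Hxy) as [Hd1 Hd2], (Q_derivatives x y Hxy) as [Hq1 Hq2].
destruct (A_derivatives x y Hxy) as [Ha1 Ha2], (B_derivatives x y Hxy) as [Hb1 Hb2].
assert (HDQ : D x y * Q x y <> 0).
{ apply Rmult_integral_contrapositive. split; [lra|assumption]. }
(* Second order: Z_q, known as the quotient A/Q in the old coordinates, is differentiated again;
   (1/Z)_p = B/(DQ) is treated likewise below. *)
destruct (transformed_derivatives _ _ x y _ _ SZy expressed_in_Dy Hxy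
  (is_derive_div _ _ x _ _ Ha1 Hq1 H1) (is_derive_div _ _ y _ _ Ha2 Hq2 H1)) as [_ ->].
assert (Hdq1 : is_derive (fun s => D s y * Q s y) x (D1 x y * Q x y + D x y * Q1 x y)).
{ apply (is_derive_mult (fun s => D s y) (fun s => Q s y)); auto. exact Rmult_comm. }
assert (Hdq2 : is_derive (fun t => D x t * Q x t) y (D2 x y * Q x y + D x y * Q2 x y)).
{ apply (is_derive_mult (fun t => D x t) (fun t => Q x t)); auto. exact Rmult_comm. }
destruct (transformed_derivatives _ _ x y _ _ SZix expressed_in_Dx_inv Hxy
  (is_derive_div _ _ x _ _ Hb1 Hdq1 HDQ) (is_derive_div _ _ y _ _ Hb2 Hdq2 HDQ)) as [-> _].
exact (transform_identity x y Hxy H1).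
Qed.

End Transform.

(** * Exchange of the variables *)

Definition swap (U : R * R -> Prop) : R * R -> Prop := fun p => U (snd p, fst p).

Lemma open_swap (U : R * R -> Prop) : open U -> open (swap U).
Proof.
apply (open_comp (fun p : R * R => (snd p, fst p)) U).
intros p _ A [e He]. exists e. intros q [H1 H2]. apply He. now split.
Qed.

(** Exchanging the arguments exchanges [Dx] and [Dy], so the induction hypothesis applies to them
    crosswise. *)
Lemma smooth_on_swap (U : R * R -> Prop) (f : R -> R -> R) :
  smooth_on U f -> smooth_on (swap U) (fun x y => f y x).
Proof.
intros Hf n. assert (H := Hf n : C_on n U f). clear Hf.
change (C_on n (swap U) (fun x y => f y x)).
assert (Hc : forall m g, C_on m U g -> forall x y, swap U (x, y) ->
  continuity_2d_pt (fun x y => g y x) x y).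
{ intros m g Hg x y Hxy e. destruct (C_on_continuity U m g y x Hg Hxy e) as [d Hd].
  exists d. intros u v Hu Hv. now apply Hd. }
revert f H. induction n as [|n IH]; intros f H.
- intros x y Hxy. split; [now apply (Hc 0%nat)|exact I].
- assert (H' := H). apply C_on_S in H. destruct H as (H & H1 & H2).
  apply C_on_S. split; [|split; [exact (IH _ H2)|exact (IH _ H1)]].
  intros x y Hxy. split; [now apply (Hc (S n))|].
  split; apply (H y x Hxy).
Qed.

Lemma image2_swap (V : R * R -> Prop) (F1 F2 : R -> R -> R) (p q : R) :
  image2 (swap V) (fun x y => F2 y x) (fun x y => F1 y x) (p, q) <-> image2 V F1 F2 (q, p).
Proof.
split; intros (x & y & Hxy & E); injection E as -> ->; exists y, x; auto.
Qed.

(** Source and target coordinates are exchanged simultaneously, so the inverse map is conjugated in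
    the same way. *)
Lemma diffeo_swap (V : R * R -> Prop) (F1 F2 : R -> R -> R) :
  diffeo_onto_image V F1 F2 ->
  diffeo_onto_image (swap V) (fun x y => F2 y x) (fun x y => F1 y x).
Proof.
intros (S1 & S2 & HI & G1 & G2 & T1 & T2 & HG).
assert (Hsub : forall f, smooth_on (image2 V F1 F2) f ->
  smooth_on (image2 (swap V) (fun x y => F2 y x) (fun x y => F1 y x)) (fun p q => f q p)).
{ intros f Hf n p q Hpq. apply (smooth_on_swap _ f Hf). now apply image2_swap. }
split; [now apply smooth_on_swap|]. split; [now apply smooth_on_swap|]. split.
- apply (open_ext (swap (image2 V F1 F2))); [|now apply open_swap].
  intros [p q]. symmetry. apply image2_swap.
- exists (fun p q => G2 q p), (fun p q => G1 q p).
  split; [now apply Hsub|]. split; [now apply Hsub|].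
  intros x y Hxy. split; now apply HG.
Qed.

(** Under z -> 1/z(y, x) the terms z_yy and (1/z)_xx trade places. As [U'] is only required to map
    into [U], restriction to a smaller open set is covered as well. *)
Lemma solution_swap (U U' : R * R -> Prop) (z z' : R -> R -> R) :
  open U -> open U' -> (forall x y, U' (x, y) -> U (y, x)) ->
  (forall x y, z' x y = 1 / z y x) ->
  constant_astigmatism_solution U z -> constant_astigmatism_solution U' z'.
Proof.
intros HU HU' Hsub Hz' (Hz & H0 & Heq).
(* Because / 0 = 0, double inversion is the identity at every point, not only on [U]; the
   derivatives below can thus be compared by global extensionality. *)
assert (H1z' : forall x y, 1 / z' x y = z y x).
{ intros x y. rewrite Hz'. unfold Rdiv. rewrite !Rmult_1_l. apply Rinv_inv. }
split; [|split].
- intros n. refine (C_on_ext U' HU' n (fun x y => 1 / z y x) _ _ _).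
  { intros x y _. now rewrite Hz'. }
  assert (Hi := smooth_on_swap U _ (smooth_on_inv U z HU H0 Hz)).
  intros x y Hxy. exact (Hi n x y (Hsub x y Hxy)).
- intros x y Hxy H. apply (H0 y x); [now apply Hsub|]. rewrite <- H1z', H.
  unfold Rdiv. now rewrite Rinv_0, Rmult_0_r.
- intros x y Hxy. rewrite <- (Heq y x (Hsub x y Hxy)), (Rplus_comm (partial_derive 0 2 z y x)).
  f_equal. f_equal.
  + exact (Derive_n_ext (fun t => z' x t) (fun s => 1 / z s x) 2 y (Hz' x)).
  + exact (Derive_n_ext (fun s => 1 / z' s y) (fun t => z y t) 2 x (fun s => H1z' s y)).
Qed.

(** * Both transformations of a solution *)

Theorem proposition1 (U : R * R -> Prop) (z xi eta : R -> R -> R)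
  (hUopen : open U) (hUsc : simply_connected U)
  (hzpos : forall x y : R, U (x, y) -> 0 < z x y)
  (hz : constant_astigmatism_solution U z)
  (heta : eta_potential U z eta)
  (hxi : xi_potential U z xi) :
  (forall V : R * R -> Prop, open V -> (forall p : R * R, V p -> U p) ->
     let x' := fun x y : R => x * z x y / (x ^ 2 * z x y + 1) in
     let y' := eta in
     let z' := fun x y : R => (x ^ 2 * z x y + 1) ^ 2 / z x y in
     diffeo_onto_image V x' y' ->
     forall Z : R -> R -> R, expressed_in V x' y' z' Z ->
       constant_astigmatism_solution (image2 V x' y') Z)
  /\
  (forall V : R * R -> Prop, open V -> (forall p : R * R, V p -> U p) ->
     let xs := xi in
     let ys := fun x y : R => y / (y ^ 2 + z x y) in
     let zs := fun x y : R => z x y / (y ^ 2 + z x y) ^ 2 in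
     diffeo_onto_image V xs ys ->
     forall Z : R -> R -> R, expressed_in V xs ys zs Z ->
       constant_astigmatism_solution (image2 V xs ys) Z).
Proof.
split; intros V HV HVU.
- intros x' y' z' HF Z HZ.
  apply (transformed_solution V z x' y' Z); auto.
  + destruct hz as (Hs & H0 & Heq). split; [|split]; auto.
    intros n x y Hxy. apply Hs. auto.
  + intros x y Hxy. apply heta. auto.
- intros xs ys zs HF Z HZ.
  assert (HVo := open_swap V HV).
  assert (Hpos : forall x y, swap V (x, y) -> 0 < z y x) by (intros x y Hxy; apply hzpos, HVU, Hxy).
  assert (HFs := diffeo_swap V xs ys HF).
  (* For w(x, y) = 1/z(y, x), the swapped y* plays the part of x' and the swapped [xi] that of
     [eta]. *)
  set (Xs := fun x y => ys y x) in HFs. set (Ys := fun x y => xs y x) in HFs.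
  assert (HIs : open (image2 (swap V) Xs Ys)) by apply HFs.
  assert (HI : open (image2 V xs ys)) by apply HF.
  (* [Z] is the conjugate of 1/Z(q, p), which is shown to be the first transform of w. *)
  apply (solution_swap (image2 (swap V) Xs Ys) _ (fun p q => 1 / Z q p)); auto.
  { intros p q. apply image2_swap. }
  { intros p q. unfold Rdiv. rewrite !Rmult_1_l. now rewrite Rinv_inv. }
  apply (transformed_solution (swap V) (fun x y => 1 / z y x) Xs Ys); auto.
  + intros x y Hxy. specialize (Hpos x y Hxy). apply Rdiv_lt_0_compat; lra.
  + apply (solution_swap U _ z); auto.
  + intros x y Hxy. specialize (Hpos x y Hxy).
    destruct (hxi y x (HVU _ Hxy)) as [H1 H2].
    assert (Hz1 : is_derive (fun s => z s x) y (partial_derive 1 0 z y x)).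
    { apply (smooth_on_is_derive U z y x (proj1 hz) (HVU _ Hxy)). }
    assert (E1 : partial_derive 0 1 (fun x y => 1 / z y x) x y
                 = - partial_derive 1 0 z y x / z y x ^ 2).
    { apply is_derive_unique. auto_derive; [split; [eexists; exact Hz1|]; split; [lra|exact I]|].
      rewrite_derive. field. lra. }
    assert (Hz2 : is_derive (fun t => z y t) x (partial_derive 0 1 z y x)).
    { apply (smooth_on_is_derive U z y x (proj1 hz) (HVU _ Hxy)). }
    assert (E2 : partial_derive 1 0 (fun x y => 1 / z y x) x y
                 = - partial_derive 0 1 z y x / z y x ^ 2).
    { apply (is_derive_unique (fun s => 1 / z y s)).
      auto_derive; [split; [eexists; exact Hz2|]; split; [lra|exact I]|].
      rewrite_derive. field. lra. }
    (* With z taken at (y, x), w_y = -z_x/z^2 and w_x = -z_y/z^2 turn the equations of [eta] for w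
       into those of [xi] for z with the variables exchanged. *)
    rewrite E1, E2. split.
    * replace (x * (- partial_derive 1 0 z y x / z y x ^ 2))
        with (- x * (partial_derive 1 0 z y x / z y x ^ 2)) by (field; lra).
      exact H2.
    * replace (x * (- partial_derive 0 1 z y x / z y x ^ 2 / (1 / z y x) ^ 2)
               + 1 / (1 / z y x) - x ^ 2)
        with (- x * partial_derive 0 1 z y x + z y x - x ^ 2) by (field; lra).
      exact H1.
  (* With z taken at (y, x), x w/(x^2 w + 1) = x/(x^2 + z). *)
  + intros x y Hxy. specialize (Hpos x y Hxy). unfold Xs, ys. field. split; nra.
  + intros x y Hxy. specialize (Hpos x y Hxy).
    change (1 / Z (xs y x) (ys y x) = (x ^ 2 * (1 / z y x) + 1) ^ 2 / (1 / z y x)).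
    (* Both sides equal (x^2 + z)^2/z, the reciprocal of z* at (y, x). *)
    rewrite (HZ y x Hxy). unfold zs.
    field. split; nra.
Qed.
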